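(* Let $b_0>0$. Define $B_0=b_0$ and $B_j=B_{j-1}+\frac{1}{B_{j-1}}$ for $j\ge1$, and $S_0=0$, $S_j=S_{j-1}+\frac{1}{B_{j-1}}$ for $j\ge1$. Let $d_j=1$ for all integers $j\ge0$. Let $F:\mathbb{R}\to\mathbb{R}$ be the function built from $(S_j)$ and $(d_j)$ as described in the context. Let $\theta_0=0$ and let $(\theta_j)_{j\ge1}$ be generated by the WNGrad method $$\theta_k=\theta_{k-1}-\frac{1}{b_{k-1}}\dot F(\theta_{k-1}),\qquad b_k=b_{k-1}+\frac{|\dot F(\theta_k)|^2}{b_{k-1}},\qquad k=1,2,\dots.$$ Then $\lim_j F(\theta_j)=\infty$ and $\inf_j|\dot F(\theta_j)|=1$.
   Context: $\dot F$ denotes the derivative of $F$. For $m>0$ and $d,\delta\in(0,1]$ let $f(\cdot\,;m,d,\delta):[0,m]\to\mathbb{R}$ be given by $$f(\theta;m,d,\delta)=\begin{cases} -d\theta & \theta\in(0,\frac{2-d}{16}m)\\ \frac{8}{m}(\theta-\frac m8)^2-m\frac{-d^2+4d}{32} & \theta\in[\frac{2-d}{16}m,\frac{3}{16}m)\\ -\frac{5m}{16}\exp\left(\frac{5/16}{\theta/m-1/2}+1\right)+m\frac{11+d^2-4d}{32} & \theta\in(\frac{3}{16}m,\frac12 m)\\ m\frac{11+d^2-4d}{32} & \theta=\frac12 m\\ \frac{5m}{16}\exp\left(\frac{-5/16}{\theta/m-1/2}+1\right)+m\frac{11+d^2-4d}{32} & \theta\in(\frac12 m,\frac{13}{16}m)\\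 -\frac{8}{m}(\theta-\frac{7m}{8})^2+m\frac{22+d^2-4d}{32} & \theta\in[\frac{13}{16}m,\frac{\delta+14}{16}m)\\ -\delta\theta+m\frac{22+d^2+\delta^2-4d+28\delta}{32} & \theta\in[\frac{\delta+14}{16}m,m] \end{cases}$$ and extended to $\theta=0$ and $\theta=\frac{3}{16}m$ by continuity. Given a strictly increasing real sequence $(S_j)_{j\ge0}$ and a sequence $(d_j)_{j\ge 0}$ in $(0,1]$, the function $F$ is defined (recursively in $j$) on $(-\infty,\sup_j S_j)$ by $F(\theta)=-d_0(\theta-S_0)$ for $\theta\le S_0$; $F(\theta)=f(\theta-S_0;S_1-S_0,d_0,d_1)$ for $\theta\in(S_0,S_1]$; and $F(\theta)=f(\theta-S_j;S_{j+1}-S_j,d_j,d_{j+1})+F(S_j)$ for $\theta\in(S_j,S_{j+1}]$, $j=1,2,\dots$. It is defined on all of $\mathbb{R}$ when $\sup_j S_j=\infty$. *)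

(* Defs.v *)
From HB Require Import structures.
From mathcomp Require Import all_boot all_order all_algebra.
From mathcomp Require Import all_classical all_reals all_analysis.
From mathcomp Require Import ring lra.
Set Implicit Arguments.
Unset Strict Implicit.
Unset Printing Implicit Defensive.
Import Order.TTheory GRing.Theory Num.Theory.
Import numFieldNormedType.Exports.
Local Open Scope classical_set_scope.
Local Open Scope ring_scope.

(* Only meaningful for [theta] in [[0, m]].  The values at [theta = 0] and
   [theta = 3 / 16 * m] are the continuous extensions: they are obtained by
   closing the first and second cases at these points, which is justified by
   [f_cvg0] and [f_continuous_3_16] below. *)
Definition f (R : realType) (theta m d delta : R) : R :=
  if theta < (2 - d) / 16 * m then
    - d * theta
  else if theta <= 3 / 16 * m then
    8 / m * (theta - m / 8) ^+ 2 - m * ((- d ^+ 2 + 4 * d) / 32)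
  else if theta < m / 2 then
    - (5 * m / 16) * expR ((5 / 16) / (theta / m - 1 / 2) + 1)
      + m * ((11 + d ^+ 2 - 4 * d) / 32)
  else if theta == m / 2 then
    m * ((11 + d ^+ 2 - 4 * d) / 32)
  else if theta < 13 / 16 * m then
    5 * m / 16 * expR (- (5 / 16) / (theta / m - 1 / 2) + 1)
      + m * ((11 + d ^+ 2 - 4 * d) / 32)
  else if theta < (delta + 14) / 16 * m then
    - (8 / m) * (theta - 7 * m / 8) ^+ 2
      + m * ((22 + d ^+ 2 - 4 * d) / 32)
  else
    - delta * theta
      + m * ((22 + d ^+ 2 + delta ^+ 2 - 4 * d + 28 * delta) / 32).

Lemma f_cvg0 (R : realType) (m d delta : R) :
  0 < m -> 0 < d <= 1 ->
  f x m d delta @[x --> 0^'+] --> f 0 m d delta.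
Proof.
move=> m0 /andP[d0 d1].
have e0 : 0 < (2 - d) / 16 * m by nra.
have -> : f 0 m d delta = - d * 0 by rewrite /f e0.
apply: cvg_trans; last first.
  apply: (@cvg_at_right_filter _ _ (fun x : R => - d * x)).
  by apply: cvgM; [exact: cvg_cst|exact: cvg_id].
apply: near_eq_cvg; near=> x.
by rewrite /f ifT//; near: x; exact: nbhs_right_lt.
Unshelve. all: by end_near. Qed.

Lemma f_continuous_3_16 (R : realType) (m d delta : R) :
  0 < m -> 0 < d <= 1 ->
  {for 3 / 16 * m, continuous (fun x : R => f x m d delta)}.
Proof.
move=> m0 /andP[d0 d1].
set a := 3 / 16 * m.
have la : (2 - d) / 16 * m < a by rewrite /a; nra.
have am : a < m / 2 by rewrite /a; nra.
have fa : f a m d delta = 8 / m * (a - m / 8) ^+ 2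
    - m * ((- d ^+ 2 + 4 * d) / 32).
  by rewrite /f ltNge (ltW la) lexx.
apply/left_right_continuousP; split; rewrite fa.
  apply: cvg_trans; last first.
    apply: (@cvg_at_left_filter _ _ (fun x : R => 8 / m * (x - m / 8) ^+ 2
      - m * ((- d ^+ 2 + 4 * d) / 32))).
    apply: cvgB; last exact: cvg_cst.
    apply: cvgM; first exact: cvg_cst.
    apply: (@continuous_cvg _ R R _ _ _ (fun y : R => y ^+ 2)).
      exact: exprn_continuous.
    by apply: cvgB; [exact: cvg_id|exact: cvg_cst].
  apply: near_eq_cvg; near=> x.
  have lx : (2 - d) / 16 * m < x by near: x; exact: nbhs_left_gt.
  have xa : x < a by near: x; exact: nbhs_left_lt.
  by rewrite /f ltNge (ltW lx)/= (ltW xa).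
have -> : 8 / m * (a - m / 8) ^+ 2 - m * ((- d ^+ 2 + 4 * d) / 32) =
    - (5 * m / 16) * expR ((5 / 16) / (a / m - 1 / 2) + 1)
      + m * ((11 + d ^+ 2 - 4 * d) / 32).
  have -> : (5 / 16) / (a / m - 1 / 2) + 1 = 0 :> R.
    have -> : a / m - 1 / 2 = - (5 / 16) by rewrite /a; field; lra.
    by field.
  by rewrite expR0 /a; field; lra.
apply: cvg_trans; last first.
  apply: (@cvg_at_right_filter _ _ (fun x : R =>
    - (5 * m / 16) * expR ((5 / 16) / (x / m - 1 / 2) + 1)
      + m * ((11 + d ^+ 2 - 4 * d) / 32))).
  apply: cvgD; last exact: cvg_cst.
  apply: cvgM; first exact: cvg_cst.
  apply: continuous_cvg; first exact: continuous_expR.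
  apply: cvgD; last exact: cvg_cst.
  apply: cvgM; first exact: cvg_cst.
  apply: cvgV.
    have -> : a / m - 1 / 2 = - (5 / 16) by rewrite /a; field; lra.
    by lra.
  apply: cvgB; last exact: cvg_cst.
  by apply: cvgM; [exact: cvg_id|exact: cvg_cst].
apply: near_eq_cvg; near=> x.
have xm : x < m / 2 by near: x; exact: nbhs_right_lt.
have ax : a < x by near: x; exact: nbhs_right_gt.
by rewrite /f ltNge (ltW (lt_trans la ax))/= leNgt ax/= xm.
Unshelve. all: by end_near. Qed.

(* The values [F S d (S j)] of the function below, see [F_node]. *)
Fixpoint Fnode (R : realType) (S d : nat -> R) (j : nat) : R :=
  if j is i.+1 then
    f (S i.+1 - S i) (S i.+1 - S i) (d i) (d i.+1) + Fnode S d i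
  else 0.

(* [xget] selects the unique [j] with [S j < theta <= S j.+1].  No such [j]
   exists when [theta] is above [S 0] and all [S j] are below [theta]; such
   [theta] lie outside the domain of the function and get a junk value.  The
   lemmas [F_le0], [F_seg0] and [F_seg] are the defining recursive equations. *)
Definition F (R : realType) (S d : nat -> R) (theta : R) : R :=
  if theta <= S 0%N then - d 0%N * (theta - S 0%N)
  else let j := xget 0%N [set j | S j < theta <= S j.+1] in
       f (theta - S j) (S j.+1 - S j) (d j) (d j.+1) + Fnode S d j.

Lemma F_le0 (R : realType) (S d : nat -> R) (theta : R) :
  theta <= S 0%N -> F S d theta = - d 0%N * (theta - S 0%N).
Proof. by rewrite /F => ->. Qed.

Lemma F_segE (R : realType) (S d : nat -> R) (j : nat) (theta : R) :
  {homo S : i k / (i < k)%N >-> i < k} -> S j < theta <= S j.+1 ->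
  F S d theta = f (theta - S j) (S j.+1 - S j) (d j) (d j.+1) + Fnode S d j.
Proof.
move=> Sinc jth.
have Sle i k : (i <= k)%N -> S i <= S k.
  by rewrite leq_eqVlt => /predU1P[->//|/Sinc/ltW].
have key i : S i < theta <= S i.+1 -> i = j.
  move: jth => /andP[j1 j2] /andP[i1 i2].
  have [ij|ji|//] := ltngtP i j.
  - by have := lt_le_trans j1 (le_trans i2 (Sle _ _ ij)); rewrite ltxx.
  - by have := lt_le_trans i1 (le_trans j2 (Sle _ _ ji)); rewrite ltxx.
rewrite /F ifF; last first.
  apply/negbTE; rewrite -ltNge; apply: (le_lt_trans (Sle _ _ (leq0n j))).
  by case/andP: jth.
have xj : xget 0%N [set i | S i < theta <= S i.+1] = j.
  apply: key.
  exact: (@xgetI _ 0%N [set i | S i < theta <= S i.+1] j jth).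
by rewrite xj.
Qed.

Lemma F_node (R : realType) (S d : nat -> R) (j : nat) :
  {homo S : i k / (i < k)%N >-> i < k} -> F S d (S j) = Fnode S d j.
Proof.
case: j => [|j] Sinc; first by rewrite F_le0// subrr mulr0.
by rewrite (@F_segE _ _ _ j)// lexx Sinc.
Qed.

Lemma F_seg0 (R : realType) (S d : nat -> R) (theta : R) :
  {homo S : i k / (i < k)%N >-> i < k} -> S 0%N < theta <= S 1%N ->
  F S d theta = f (theta - S 0%N) (S 1%N - S 0%N) (d 0%N) (d 1%N).
Proof. by move=> Sinc th; rewrite (F_segE _ Sinc th) addr0. Qed.

Lemma F_seg (R : realType) (S d : nat -> R) (j : nat) (theta : R) :
  {homo S : i k / (i < k)%N >-> i < k} ->
  (1 <= j)%N -> S j < theta <= S j.+1 ->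
  F S d theta
    = f (theta - S j) (S j.+1 - S j) (d j) (d j.+1) + F S d (S j).
Proof. by move=> Sinc _ th; rewrite (F_segE _ Sinc th) F_node. Qed.

Definition wngrad (R : realType) (g : R -> R) (theta0 b0 : R)
    (theta b : nat -> R) : Prop :=
  [/\ theta 0%N = theta0, b 0%N = b0 &
      forall k : nat,
        theta k.+1 = theta k - 1 / b k * g^`()%classic (theta k) /\
        b k.+1 = b k + `|g^`()%classic (theta k.+1)| ^+ 2 / b k].

(* Main.v *)
Require Import Defs.
From HB Require Import structures.
From mathcomp Require Import all_boot all_order all_algebra.
From mathcomp Require Import all_classical all_reals all_analysis.
From mathcomp Require Import ring lra.
Set Implicit Arguments.
Unset Strict Implicit.
Unset Printing Implicit Defensive.
Import Order.TTheory GRing.Theory Num.Theory.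
Import numFieldNormedType.Exports.
Local Open Scope classical_set_scope.
Local Open Scope ring_scope.

(** Both pieces of [F] that meet at a node [S j] are affine with slope [- d j]
    near it ([f_head], [f_tail]), so [F] has derivative [- d j] at [S j]
    ([derive1_F_node]). With unit slopes, [F] looks decreasing at every node,
    and yet from each node to the next it gains half of the gap ([f_end])
    through the steep part in between, which a method evaluating the gradient
    only at nodes never sees.

    When all slopes are [-1], a WNGrad iterate sitting at [S k] with
    [b k = B k] moves by [+ 1 / B k], which is exactly the distance to [S k.+1],
    and the denominator becomes [B k + 1 / B k = B k.+1]. By induction the
    iterates are the nodes ([wngrad_nodes]): the gradient has absolute value [1]
    at every iterate, and the value of [F] is [S k / 2] ([Fnode_half]).

    Finally [S k = B k - B 0], because both sequences have the same increments,
    and [B] tends to infinity because each step increases its square by more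
    than [2] ([add_inv_rec_cvgy]). *)

Lemma f_head (R : realType) (x m d delta : R) :
  x < (2 - d) / 16 * m -> f x m d delta = - d * x.
Proof. by rewrite /f => ->. Qed.

Lemma f_tail (R : realType) (x m d delta : R) :
  0 < m -> 0 < d -> 0 < delta -> (delta + 14) / 16 * m <= x ->
  f x m d delta = - delta * x
    + m * ((22 + d ^+ 2 + delta ^+ 2 - 4 * d + 28 * delta) / 32).
Proof.
move=> m0 d0 e0 tx; rewrite /f.
have xm : 14 / 16 * m < x by apply: lt_le_trans tx; nra.
rewrite ifN ?ifN ?ifN ?ifN ?ifN ?ifN//.
- by rewrite -leNgt.
- by rewrite -leNgt; lra.
- by rewrite gt_eqF//; lra.
- by rewrite -leNgt; lra.
- by rewrite -ltNge; lra.
- by rewrite -leNgt; nra.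
Qed.

Lemma f_end (R : realType) (m d delta : R) :
  0 < m -> 0 < d -> 0 < delta <= 1 ->
  f m m d delta = m * ((22 + d ^+ 2 + delta ^+ 2 - 4 * d - 4 * delta) / 32).
Proof.
move=> m0 d0 /andP[e0 e1]; rewrite f_tail//; last by nra.
by field.
Qed.

(** The affine ends of two consecutive pieces have matching slopes, so that [F]
    is affine on a two-sided neighbourhood of each node. *)
Lemma F_affine_near_node (R : realType) (S d : nat -> R) (j : nat) :
  {homo S : i k / (i < k)%N >-> i < k} -> (forall i, 0 < d i <= 1) ->
  \forall x \near S j, F S d x = F S d (S j) - d j * (x - S j).
Proof.
move=> Sinc d01; rewrite F_node//.
have [d0 d1] : 0 < d j /\ d j <= 1 by apply/andP.
have mpos i : 0 < S i.+1 - S i by rewrite subr_gt0 Sinc.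
have right_of x : S j < x -> x < S j + (2 - d j) / 16 * (S j.+1 - S j) ->
    F S d x = Fnode S d j - d j * (x - S j).
  move=> jx xr; have mj := mpos j; rewrite (@F_segE _ _ _ j)//.
    by rewrite f_head; [ring|lra].
  by rewrite jx/=; nra.
have rnbhs : S j < S j + (2 - d j) / 16 * (S j.+1 - S j).
  by have mj := mpos j; nra.
case: j d0 d1 right_of rnbhs => [|i] d0 d1 right_of rnbhs.
  near=> x; have [x0|x0] := leP x (S 0%N).
    by rewrite F_le0//=; ring.
  by apply: right_of => //; near: x; exact: lt_nbhsl.
have mi := mpos i.
have [c0 c1] : 0 < d i /\ d i <= 1 by apply/andP.
near=> x; have [xi|xi] := leP x (S i.+1).
  have lx : S i + (d i.+1 + 14) / 16 * (S i.+1 - S i) < x.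
    by near: x; apply: lt_nbhsr; nra.
  rewrite (@F_segE _ _ _ i)//; last by rewrite xi andbT; nra.
  by rewrite /= f_end ?f_tail ?d0 ?d1//; [field|lra].
by apply: right_of => //; near: x; exact: lt_nbhsl.
Unshelve. all: by end_near. Qed.

Lemma derive1_F_node (R : realType) (S d : nat -> R) (j : nat) :
  {homo S : i k / (i < k)%N >-> i < k} -> (forall i, 0 < d i <= 1) ->
  (F S d)^`()%classic (S j) = - d j.
Proof.
move=> Sinc d01; rewrite derive1E.
have aff : is_derive (S j) (1 : R)
    (fun x : R => F S d (S j) - d j * (x - S j)) (- d j).
  by apply: is_derive_eq; rewrite subr0 add0r mul1r [_ *: _]mulr1.
rewrite (@near_eq_derive _ _ _ _ (fun x => F S d (S j) - d j * (x - S j)))//.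
  exact: derive_val.
exact: F_affine_near_node.
Qed.

Lemma Fnode_half (R : realType) (S d : nat -> R) (j : nat) :
  {homo S : i k / (i < k)%N >-> i < k} -> (forall i, d i = 1) ->
  Fnode S d j = (S j - S 0%N) / 2.
Proof.
move=> Sinc d1; elim: j => [|j IH] /=; first by rewrite subrr mul0r.
rewrite IH !d1 f_end ?ltr01 ?lexx// ?subr_gt0 ?Sinc//.
by field.
Qed.

(** The square of [B] grows by more than [2] at each step, which forces
    [B j ^+ 2 >= 2 j]. *)
Lemma add_inv_rec_cvgy (R : realType) (B : nat -> R) :
  0 < B 0%N -> (forall j, B j.+1 = B j + 1 / B j) -> B @ \oo --> +oo.
Proof.
move=> B0 Brec.
have Bpos j : 0 < B j.
  by elim: j => // j IH; rewrite Brec addr_gt0// divr_gt0.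
have Bsq j : 2 * j%:R <= B j ^+ 2.
  elim: j => [|j IH]; first by rewrite mulr0 sqr_ge0.
  have Bj := Bpos j; have Vj : 0 < (B j)^-1 by rewrite invr_gt0.
  have -> : B j.+1 ^+ 2 = B j ^+ 2 + 2 + (B j)^-1 ^+ 2.
    by rewrite Brec; field; rewrite gt_eqF.
  by rewrite -natr1; nra.
apply/cvgryPge => A; near=> j.
rewrite leNgt; apply/negP => BA.
have jA : A ^+ 2 <= j%:R by near: j; exact: nbhs_infty_ger.
by have := Bsq j; have := Bpos j; nra.
Unshelve. all: by end_near. Qed.

(** If the gaps of [S] are the steps [1 / B j] that unit gradients would cause,
    the method reproduces [S] and [B]. *)
Lemma wngrad_nodes (R : realType) (g : R -> R) (B S theta b : nat -> R) :
  (forall j, B j.+1 = B j + 1 / B j) -> (forall j, S j.+1 = S j + 1 / B j) ->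
  (forall j, g^`()%classic (S j) = - 1) ->
  wngrad g (S 0%N) (B 0%N) theta b -> theta =1 S /\ b =1 B.
Proof.
move=> Brec Srec g1 [th0 b_0 step].
suff nodes k : theta k = S k /\ b k = B k by split=> k; have [] := nodes k.
elim: k => [//|k [thk bk]].
have [thS bS] := step k.
have thS1 : theta k.+1 = S k.+1.
  by rewrite thS thk bk g1 Srec mulrN1 opprK.
by split=> //; rewrite bS thS1 bk g1 Brec normrN1 expr1n.
Qed.

Theorem proposition3p10 (R : realType) (b0 : R) (B S d theta b : nat -> R)
  (b0_gt0 : 0 < b0)
  (B_0 : B 0%N = b0)
  (B_rec : forall j : nat, B j.+1 = B j + 1 / B j)
  (S_0 : S 0%N = 0)
  (S_rec : forall j : nat, S j.+1 = S j + 1 / B j)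
  (d_1 : forall j : nat, d j = 1)
  (theta_b : wngrad (F S d) 0 b0 theta b) :
  ((fun j : nat => F S d (theta j)) @ \oo --> +oo) /\
  inf (range (fun j : nat => `|(F S d)^`()%classic (theta j)|)) = 1.
Proof.
have Bpos j : 0 < B j.
  by elim: j => [|j IH]; rewrite ?B_0// B_rec addr_gt0// divr_gt0.
have Sinc : {homo S : i k / (i < k)%N >-> i < k}.
  apply: homo_ltn; first by move=> y x z; exact: lt_trans.
  by move=> j; rewrite S_rec ltrDl divr_gt0.
have slope j : (F S d)^`()%classic (S j) = - 1.
  by rewrite derive1_F_node// => [|i]; rewrite d_1// ltr01 lexx.
rewrite -S_0 -B_0 in theta_b.
have [thS _] := wngrad_nodes B_rec S_rec slope theta_b.
split.
  have SB j : S j = B j - b0.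
    elim: j => [|j IH]; first by rewrite S_0 B_0 subrr.
    by rewrite S_rec B_rec IH addrAC.
  have /cvgryPge Boo : B @ \oo --> +oo by apply: add_inv_rec_cvgy; rewrite ?B_0.
  apply/cvgryPge => A; apply: filterS (Boo (2 * A + b0)) => j AB.
  by rewrite thS F_node// Fnode_half// S_0 SB; lra.
rewrite [X in inf X](_ : _ = [set 1]); first exact: inf1.
have norm1 j : `|(F S d)^`()%classic (theta j)| = 1.
  by rewrite thS slope normrN1.
by apply/seteqP; split=> [_ [j _ <-]|_ ->] //=; exists 0%N.
Qed.
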